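(* Let $X$ be a set and $M(X)$ the set of multirelations over $X$. Then $(M(X),\cup,\cdot,\|,\emptyset,1_\sigma,1_\pi,d,{}^\ast)$ is a dp-bi-Kleene algebra.
   Context: A multirelation over $X$ is a subset of $X\times 2^X$. For multirelations $R,S$: $R\cdot S=\{(a,A)\mid \exists B.\,(a,B)\in R\wedge\exists f:B\to 2^X.\,(\forall b\in B.\,(b,f(b))\in S)\wedge A=\bigcup_{b\in B}f(b)\}$; $1_\sigma=\{(a,\{a\})\mid a\in X\}$; $R\|S=\{(a,A\cup B)\mid (a,A)\in R,(a,B)\in S\}$; $1_\pi=\{(a,\emptyset)\mid a\in X\}$; $d(R)=\{(a,\{a\})\mid \exists A.\,(a,A)\in R\}$; $R^\ast$ is the least fixpoint (w.r.t. $\subseteq$) of the isotone map $T\mapsto 1_\sigma\cup R\cdot T$ on $M(X)$. A dp-bi-Kleene algebra is a structure $(S,+,\cdot,\|,0,1_\sigma,1_\pi,d,{}^\ast)$ where: $+$ is associative, commutative, idempotent with unit $0$ (order $x\le y\iff x+y=y$); $1_\sigma\cdot x=x=x\cdot 1_\sigma$, $x\cdot y+x\cdot z\le x\cdot(y+z)$, $(x+y)\cdot z=x\cdot z+y\cdot z$, $0\cdot x=0$; $\|$ is associative, commutative with unit $1_\pi$, $x\|(y+z)=x\|y+x\|z$, $x\|0=0$; $x\cdot(y\cdot z)=(x\cdot y)\cdot z$ whenever one of $x,y,z$ is of the form $d(w)$; $x\le d(x)\cdot x$, $d(x\cdot y)=d(x\cdot d(y))$, $d(x+y)=d(x)+d(y)$,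 $d(x)\le 1_\sigma$, $d(0)=0$; $(x\|y)\cdot d(z)=(x\cdot d(z))\|(y\cdot d(z))$, $d(x\|y)=d(x)\cdot d(y)$, $d(x)\|d(y)=d(x)\cdot d(y)$; $1_\sigma+x\cdot x^\ast\le x^\ast$ and $d(z)+x\cdot y\le y\Rightarrow x^\ast\cdot d(z)\le y$. *)

(* Defs.v *)
From mathcomp Require Import all_boot.
From mathcomp Require Import boolp classical_sets.

Set Implicit Arguments.
Unset Strict Implicit.
Unset Printing Implicit Defensive.

Local Open Scope classical_set_scope.

Definition add_le (S : Type) (add : S -> S -> S) (x y : S) : Prop :=
  add x y = y.

Record dp_bi_kleene_algebra (S : Type) (add mul par : S -> S -> S)
    (zero one_s one_p : S) (d star : S -> S) : Prop := {
  dpA_addA : forall x y z, add x (add y z) = add (add x y) z;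
  dpA_addC : forall x y, add x y = add y x;
  dpA_addxx : forall x, add x x = x;
  dpA_add0 : forall x, add zero x = x;

  dpA_mul1l : forall x, mul one_s x = x;
  dpA_mul1r : forall x, mul x one_s = x;
  dpA_mulDr_sub : forall x y z,
    add_le add (add (mul x y) (mul x z)) (mul x (add y z));
  dpA_mulDl : forall x y z, mul (add x y) z = add (mul x z) (mul y z);
  dpA_mul0l : forall x, mul zero x = zero;

  dpA_parA : forall x y z, par x (par y z) = par (par x y) z;
  dpA_parC : forall x y, par x y = par y x;
  dpA_par1 : forall x, par one_p x = x;
  dpA_parDr : forall x y z, par x (add y z) = add (par x y) (par x z);
  dpA_par0 : forall x, par x zero = zero;

  dpA_mulA_dom : forall x y z,
    (exists w, x = d w \/ y = d w \/ z = d w) ->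
    mul x (mul y z) = mul (mul x y) z;

  dpA_dom_le : forall x, add_le add x (mul (d x) x);
  dpA_dom_local : forall x y, d (mul x y) = d (mul x (d y));
  dpA_domD : forall x y, d (add x y) = add (d x) (d y);
  dpA_dom_le1 : forall x, add_le add (d x) one_s;
  dpA_dom0 : d zero = zero;

  dpA_par_mul_dom : forall x y z,
    mul (par x y) (d z) = par (mul x (d z)) (mul y (d z));
  dpA_dom_par : forall x y, d (par x y) = mul (d x) (d y);
  dpA_par_dom : forall x y, par (d x) (d y) = mul (d x) (d y);

  dpA_star_unfold : forall x,
    add_le add (add one_s (mul x (star x))) (star x);
  dpA_star_ind : forall x y z,
    add_le add (add (d z) (mul x y)) y -> add_le add (mul (star x) (d z)) y
}.

Definition is_least_fixpoint (T : Type) (F : set T -> set T) (A : set T) : Prop :=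
  F A = A /\ forall B, F B = B -> A `<=` B.

Definition least_fixpoint (T : Type) (F : set T -> set T) : set T :=
  xget set0 [set A | is_least_fixpoint F A].

Section Multirelations.
Variable X : Type.

Definition multirel : Type := set (X * set X).
Implicit Types R S T : multirel.

Definition mr_union R S : multirel := R `|` S.

Definition mr_empty : multirel := set0.

(* The choice functions f : B -> 2^X are given as total functions X -> 2^X of
   which only the values on B matter. *)
Definition mr_seq R S : multirel :=
  [set p | exists B : set X, R (p.1, B) /\
           exists f : X -> set X,
             (forall b, B b -> S (b, f b)) /\ p.2 = \bigcup_(b in B) f b].

Definition mr_one_s : multirel := [set p | p.2 = [set p.1]].

Definition mr_par R S : multirel :=
  [set p | exists A B : set X, R (p.1, A) /\ S (p.1, B) /\ p.2 = A `|` B].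

Definition mr_one_p : multirel := [set p | p.2 = set0].

Definition mr_dom R : multirel :=
  [set p | p.2 = [set p.1] /\ exists A : set X, R (p.1, A)].

Definition mr_star_step R : multirel -> multirel :=
  fun T => mr_union mr_one_s (mr_seq R T).

Definition mr_star R : multirel := least_fixpoint (mr_star_step R).

End Multirelations.

Arguments mr_one_s {X}.
Arguments mr_one_p {X}.
Arguments mr_empty {X}.

(* Knaster-Tarski: the default value of [xget] is not used for isotone maps. *)
Lemma least_fixpointP (T : Type) (F : set T -> set T) :
  (forall A B, A `<=` B -> F A `<=` F B) ->
  is_least_fixpoint F (least_fixpoint F).
Proof.
move=> Fm; apply: xgetPex.
pose L := \bigcap_(A in [set A | F A `<=` A]) A.
have FL : F L `<=` L.
  by move=> x FLx A /= FA; apply: (FA); apply: Fm FLx => y Ly; exact: Ly.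
exists L; split; last by move=> B FB x; apply; rewrite /= FB.
apply/seteqP; split=> // x; apply; exact: Fm.
Qed.

Lemma mr_star_lfp (X : Type) (R : multirel X) :
  is_least_fixpoint (mr_star_step R) (mr_star R).
Proof.
apply: least_fixpointP => A B AB [a C] [?|]; first by left.
move=> [D [RD [f [fA Cf]]]]; right; exists D; split=> //.
by exists f; split=> // b /fA /AB.
Qed.

(* Main.v *)
(** Composing with a domain element on either side only restricts a
    multirelation: [d(S) . R] keeps the pairs [(a, A)] of [R] with [a] in the
    domain of [S], and [R . d(S)] keeps those with [A] included in the domain
    of [S]. The associativity and distributivity laws involving [d] follow by
    comparing such restrictions. For star induction, [R^*] is included in
    [{(a, A) | A included in dom z implies (a, A) in y}], which is a prefixed
    point of the step map as soon as [d(z) + R . y <= y]. *)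
From mathcomp Require Import all_boot.
From mathcomp Require Import boolp classical_sets.
Require Import Defs.

Set Implicit Arguments.
Unset Strict Implicit.
Unset Printing Implicit Defensive.

Local Open Scope classical_set_scope.

(** Minimality of [A] only speaks of fixpoints, whereas [B] is merely prefixed. The intersection [L]
    of all prefixed points bridges the gap: by Knaster-Tarski it is a fixpoint, so [A] lies in [L],
    and [L] lies in [B]. *)
Lemma is_least_fixpoint_ind (T : Type) (F : set T -> set T) (A B : set T) :
  (forall C D, C `<=` D -> F C `<=` F D) ->
  is_least_fixpoint F A -> F B `<=` B -> A `<=` B.
Proof.
move=> Fm [_ Amin] FB.
pose L := \bigcap_(C in [set C | F C `<=` C]) C.
have FL : F L `<=` L.
  by move=> x FLx C /= FC; apply: (FC); apply: Fm FLx => y; exact.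
have LE : F L = L.
  by apply/seteqP; split=> // x; apply; exact: Fm.
by move=> x /(Amin _ LE); apply.
Qed.

Section MultirelationLaws.
Variable X : Type.
Implicit Types R S T : multirel X.

(** The domain as a subset of [X]; [mr_dom] represents the same set as a subidentity. *)
Definition mr_support R : set X := [set a | exists A, R (a, A)].

Lemma add_le_mr_unionP R S : add_le (@mr_union X) R S <-> R `<=` S.
Proof. by split=> [/setUidPr|/setUidPr]. Qed.

Lemma mr_seq_sub R S T : S `<=` T -> mr_seq R S `<=` mr_seq R T.
Proof.
move=> ST p [B [RB [f [fS pE]]]]; exists B; split=> //.
by exists f; split=> // b /fS /ST.
Qed.

Lemma mr_star_step_sub R S T :
  S `<=` T -> mr_star_step R S `<=` mr_star_step R T.
Proof. by move=> ST; apply: setUS; exact: mr_seq_sub. Qed.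

Lemma mr_domE R a A : mr_dom R (a, A) <-> A = [set a] /\ mr_support R a.
Proof. by []. Qed.

Lemma mr_support_dom R : mr_support (mr_dom R) = mr_support R.
Proof.
apply/seteqP; split=> [a [A [_ aR]] //|a aR]; by exists [set a].
Qed.

Lemma mr_dom_eq R S : mr_support R = mr_support S -> mr_dom R = mr_dom S.
Proof.
by move=> RS; apply/seteqP; split=> -[a A] /mr_domE;
  [rewrite RS|rewrite -RS] => aRS; exact/mr_domE.
Qed.

Lemma mr_support_seq R S a :
  mr_support (mr_seq R S) a <-> exists2 B, R (a, B) & B `<=` mr_support S.
Proof.
split=> [[A [B [RB [f [fS _]]]]]|[B RB BS]].
  by exists B => // b Bb; exists (f b); exact: fS.
(* Choice needs a value at every point of [X]; outside [B] the dummy [set0] serves. *)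
have /choice[f fS] : forall b, exists C, B b -> S (b, C).
  move=> b; have [/BS[C SC]|nB] := pselect (B b); first by exists C.
  by exists set0.
by exists (\bigcup_(b in B) f b), B; split=> //; exists f.
Qed.

Lemma mr_seq_dom_l R S a A :
  mr_seq (mr_dom S) R (a, A) <-> mr_support S a /\ R (a, A).
Proof.
split=> [[B [[/= -> aS] [f [fR /= ->]]]]|[aS RA]].
  by split=> //; rewrite bigcup_set1; exact: fR.
exists [set a]; split=> //; exists (fun=> A).
by split=> [_ ->|]; rewrite /= ?bigcup_set1.
Qed.

Lemma mr_seq_dom_r R S a A :
  mr_seq R (mr_dom S) (a, A) <-> R (a, A) /\ A `<=` mr_support S.
Proof.
split=> [[B [RB [f [fS /= ->]]]]|[RA AS]].
  (* Each [f b] is forced to be the singleton of [b], so the union gives back [B]. *)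
  have -> : \bigcup_(b in B) f b = B.
    rewrite -[RHS]image_id -bigcup_imset1.
    by apply: eq_bigcupr => b /fS[].
  by split=> // b /fS[].
exists A; split=> //; exists set1; split=> [b /AS bS //|].
by rewrite /= bigcup_imset1 image_id.
Qed.

(** Turns both unit laws into restrictions to a full support. *)
Lemma mr_one_sE : @mr_one_s X = mr_dom setT.
Proof.
by apply/seteqP; split=> [p pE|p []//]; split=> //; exists set0.
Qed.

Lemma mr_seq1l R : mr_seq mr_one_s R = R.
Proof.
rewrite mr_one_sE; apply/seteqP; split=> -[a A].
  by move=> /mr_seq_dom_l[].
by move=> RA; apply/mr_seq_dom_l; split=> //; exists set0.
Qed.

Lemma mr_seq1r R : mr_seq R mr_one_s = R.
Proof.
rewrite mr_one_sE; apply/seteqP; split=> -[a A].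
  by move=> /mr_seq_dom_r[].
by move=> RA; apply/mr_seq_dom_r; split=> // b _; exists set0.
Qed.

Lemma mr_seqUl R S T :
  mr_seq (mr_union R S) T = mr_union (mr_seq R T) (mr_seq S T).
Proof.
apply/seteqP; split=> [p [B [[RB|SB] fT]]|p [[B [RB fT]]|[B [SB fT]]]].
- by left; exists B.
- by right; exists B.
- by exists B; split=> //; left.
- by exists B; split=> //; right.
Qed.

Lemma mr_parA R S T : mr_par R (mr_par S T) = mr_par (mr_par R S) T.
Proof.
apply/seteqP; split=> -[a D].
- move=> [A [E [RA [[B [C [/= SB [/= TC ->]]]] /= ->]]]].
  by exists (A `|` B), C; rewrite setUA; split; first by exists A, B.
- move=> [E [C [[A [B [/= RA [/= SB ->]]]] [TC /= ->]]]].
  by exists A, (B `|` C); rewrite setUA; split=> //; split=> //; exists B, C.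
Qed.

Lemma mr_parC R S : mr_par R S = mr_par S R.
Proof.
by apply/seteqP; split=> p [A [B [RA [SB pE]]]]; exists B, A; rewrite setUC.
Qed.

Lemma mr_par1 R : mr_par mr_one_p R = R.
Proof.
apply/seteqP; split=> -[a A].
  by move=> [E [B [E0 [RB /= ->]]]]; rewrite (E0 : E = set0) set0U.
by move=> RA; exists set0, A; rewrite set0U.
Qed.

Lemma mr_parUr R S T :
  mr_par R (mr_union S T) = mr_union (mr_par R S) (mr_par R T).
Proof.
apply/seteqP; split=> [p [A [B [RA [[SB|TB] pE]]]]|p].
- by left; exists A, B.
- by right; exists A, B.
- move=> [[A [B [RA [SB pE]]]]|[A [B [RA [TB pE]]]]]; exists A, B.
    by split=> //; split=> //; left.
  by split=> //; split=> //; right.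
Qed.

Lemma mr_seqA_dom_l R S T :
  mr_seq (mr_dom R) (mr_seq S T) = mr_seq (mr_seq (mr_dom R) S) T.
Proof.
apply/seteqP; split=> -[a A].
  move=> /mr_seq_dom_l[aR [B [SB fT]]].
  by exists B; split=> //; exact/mr_seq_dom_l.
move=> [B [/mr_seq_dom_l[aR SB] fT]].
by apply/mr_seq_dom_l; split=> //; exists B.
Qed.

(** Both sides require the intermediate set [B] to lie in the support of [S], on the left point by
    point and on the right all at once. *)
Lemma mr_seqA_dom_m R S T :
  mr_seq R (mr_seq (mr_dom S) T) = mr_seq (mr_seq R (mr_dom S)) T.
Proof.
apply/seteqP; split=> -[a A].
  move=> [B [RB [f [fST AE]]]]; exists B; split.
    by apply/mr_seq_dom_r; split=> // b /fST/mr_seq_dom_l[].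
  by exists f; split=> // b /fST/mr_seq_dom_l[].
move=> [B [/mr_seq_dom_r[RB BS] [f [fT AE]]]]; exists B; split=> //.
exists f; split=> // b Bb.
by apply/mr_seq_dom_l; split; [exact: BS|exact: fT].
Qed.

(** A union lies in the support of [T] exactly when each of its members [f b] does. *)
Lemma mr_seqA_dom_r R S T :
  mr_seq R (mr_seq S (mr_dom T)) = mr_seq (mr_seq R S) (mr_dom T).
Proof.
apply/seteqP; split=> -[a A].
  move=> [B [RB [f [fST /= AE]]]]; apply/mr_seq_dom_r; split.
    exists B; split=> //; exists f; split=> // b.
    by move=> /fST/mr_seq_dom_r[].
  by rewrite AE => c [b /fST/mr_seq_dom_r[_ fbT]] /fbT.
move=> /mr_seq_dom_r[[B [RB [f [fS /= AE]]]] AT].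
exists B; split=> //; exists f; split=> // b Bb.
apply/mr_seq_dom_r; split; first exact: fS.
by move=> c fbc; apply: AT; rewrite AE; exists b.
Qed.

(** By [mr_support_seq], the support of a composition depends on the right factor only through its
    support. *)
Lemma mr_dom_seq R S : mr_dom (mr_seq R S) = mr_dom (mr_seq R (mr_dom S)).
Proof.
by apply: mr_dom_eq; apply/seteqP; split=> a /mr_support_seq[B RB BS];
  apply/mr_support_seq; exists B; rewrite ?mr_support_dom // -mr_support_dom.
Qed.

Lemma mr_domU R S : mr_dom (mr_union R S) = mr_union (mr_dom R) (mr_dom S).
Proof.
apply/seteqP; split=> [p [pE [A [RA|SA]]]|p [[pE [A RA]]|[pE [A SA]]]].
- by left; split=> //; exists A.
- by right; split=> //; exists A.
- by split=> //; exists A; left.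
- by split=> //; exists A; right.
Qed.

Lemma mr_par_seq_dom R S T :
  mr_seq (mr_par R S) (mr_dom T) =
  mr_par (mr_seq R (mr_dom T)) (mr_seq S (mr_dom T)).
Proof.
apply/seteqP; split=> -[a C].
  move=> /mr_seq_dom_r[[A [B [RA [SB /= ->]]]]]; rewrite subUset => -[AT BT].
  by exists A, B; split; [|split=> //]; exact/mr_seq_dom_r.
move=> [A [B [/mr_seq_dom_r[RA AT] [/mr_seq_dom_r[SB BT] /= ->]]]].
by apply/mr_seq_dom_r; split; [exists A, B|rewrite subUset].
Qed.

(** Both sides are the subidentity on the intersection of the two supports. *)
Lemma mr_dom_par R S : mr_dom (mr_par R S) = mr_seq (mr_dom R) (mr_dom S).
Proof.
apply/seteqP; split=> -[a C].
  move=> [/= -> [E [A [B [RA [SB _]]]]]].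
  by apply/mr_seq_dom_l; split; [exists A|split=> //; exists B].
move=> /mr_seq_dom_l[[A RA] [/= -> [B SB]]].
by split=> //; exists (A `|` B), A, B.
Qed.

Lemma mr_par_dom R S :
  mr_par (mr_dom R) (mr_dom S) = mr_seq (mr_dom R) (mr_dom S).
Proof.
apply/seteqP; split=> -[a C].
  move=> [A [B [[/= -> aR] [[/= -> aS] /= ->]]]].
  by apply/mr_seq_dom_l; rewrite setUid.
move=> /mr_seq_dom_l[aR [/= -> aS]].
by exists [set a], [set a]; rewrite setUid.
Qed.

Lemma mr_star_ind R S T :
  mr_union (mr_dom T) (mr_seq R S) `<=` S ->
  mr_seq (mr_star R) (mr_dom T) `<=` S.
Proof.
rewrite subUset => -[TS RS] [a A] /mr_seq_dom_r[].
(* [P] is the largest multirelation whose composition with [mr_dom T] is included in [S]. *)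
pose P : multirel X := [set p | p.2 `<=` mr_support T -> S p].
suff starP : mr_star R `<=` P by move=> /starP.
apply: (is_least_fixpoint_ind _ (mr_star_lfp R)); first exact: mr_star_step_sub.
move=> {a A} [a A] [A1 AT|[B [RB [f [fP /= AE]]]] /= AT].
  (* Unit part: [A] is the singleton of [a], so [a] is in the support of [T]. *)
  by apply: TS; split=> //; apply: AT; rewrite A1.
apply: RS; exists B; split=> //; exists f; split=> // b Bb.
(* Each [f b] is included in the union [A], hence in the support of [T]. *)
by apply: fP => //= c fbc; apply: AT; rewrite AE; exists b.
Qed.

End MultirelationLaws.

Theorem theorem10p8 (X : Type) :
  @dp_bi_kleene_algebra (multirel X)
    (@mr_union X) (@mr_seq X) (@mr_par X)
    (@mr_empty X) (@mr_one_s X) (@mr_one_p X)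
    (@mr_dom X) (@mr_star X).
Proof.
split.
- exact: setUA.
- exact: setUC.
- exact: setUid.
- exact: set0U.
- exact: mr_seq1l.
- exact: mr_seq1r.
(* Isotony in the right factor gives only an inclusion: on the right-hand side a choice function may
   take some values from [y] and others from [z]. *)
- move=> x y z; apply/add_le_mr_unionP; rewrite subUset.
  split; apply: mr_seq_sub.
    exact: subsetUl.
  exact: subsetUr.
- exact: mr_seqUl.
- by move=> x; apply/seteqP; split=> // p [B []].
- exact: mr_parA.
- exact: mr_parC.
- exact: mr_par1.
- exact: mr_parUr.
- by move=> x; apply/seteqP; split=> // p [A [B [_ []]]].
- move=> x y z [w [->|[->|->]]].
  + exact: mr_seqA_dom_l.
  + exact: mr_seqA_dom_m.
  + exact: mr_seqA_dom_r.
- move=> x; apply/add_le_mr_unionP => -[a A] xA.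
  by apply/mr_seq_dom_l; split=> //; exists A.
- exact: mr_dom_seq.
- exact: mr_domU.
- by move=> x; apply/add_le_mr_unionP => p [].
- by apply/seteqP; split=> // p [_ []].
- exact: mr_par_seq_dom.
- exact: mr_dom_par.
- exact: mr_par_dom.
(* Unfolding is one inclusion of the fixpoint equation. *)
- move=> x; apply/add_le_mr_unionP => p.
  by have [starE _] := mr_star_lfp x; move=> px; rewrite -starE.
- move=> x y z /add_le_mr_unionP xyz.
  by apply/add_le_mr_unionP; exact: mr_star_ind.
Qed.
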